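(* Let $K$ be a field of characteristic different from $2$, let $A$ be a finite-dimensional Malcev algebra over $K$, and let $n\ge 1$ be an integer. If $A$ is right nilpotent of index $n$, then $A$ is strongly nilpotent of index less than or equal to $4n^2-2n+1$.
   Context: For a (not necessarily associative) $K$-algebra $A$, the Jacobian is $J(x,y,z)=(xy)z+(yz)x+(zx)y$. $A$ is a Malcev algebra if $x^2=0$ for all $x\in A$ and $J(x,y,xz)=J(x,y,z)x$ for all $x,y,z\in A$. The length of a product (a written expression in elements of $A$ with some bracketing) is the number of its factors, not necessarily distinct. A right product of length $m$ is $s_ms_{m-1}\cdots s_1:=((\cdots((s_ms_{m-1})s_{m-2})\cdots)s_2)s_1$. $A^n$ is the subspace spanned by all right products of length $n$ of elements of $A$. $A$ is right nilpotent if $A^n=\{0\}$ for some integer $n\ge1$; its index of right nilpotence is the least such $n$. $A^{\langle n\rangle}$ is the set of all sums of products (bracketed in any way) of elements of $A$ having at least $n$ factors. $A$ is strongly nilpotent if $A^{\langle n\rangle}=\{0\}$ for some integer $n\ge1$; its index of strong nilpotence is the least such $n$. *)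

(* Defs.v *)
From mathcomp Require Import all_boot all_order all_algebra.
From mathcomp Require Import classical_sets.

Set Implicit Arguments.
Unset Strict Implicit.
Unset Printing Implicit Defensive.

Import GRing.Theory.
Local Open Scope ring_scope.
Local Open Scope classical_set_scope.

(* A not necessarily associative K-algebra is a K-vector space A together with
   a bilinear product mul : {bilinear A -> A -> A}; a vectType is
   finite-dimensional. *)

(* A written product: elements of V with a bracketing. *)
Inductive product (V : Type) : Type :=
  | Factor of V
  | Mul of product V & product V.

Fixpoint product_length (V : Type) (p : product V) : nat :=
  match p with
  | Factor _ => 1%N
  | Mul p1 p2 => (product_length p1 + product_length p2)%N
  end.

Fixpoint product_value (V : Type) (mul : V -> V -> V) (p : product V) : V :=
  match p with
  | Factor x => x
  | Mul p1 p2 => mul (product_value mul p1) (product_value mul p2)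
  end.

(* [foldl] brackets to the left: a, [:: s_(m-1); ...; s_1] yields
   (...((a s_(m-1)) s_(m-2)) ...) s_1. *)
Definition right_product (V : Type) (a : V) (s : seq V) : product V :=
  foldl (fun p x => Mul p (Factor x)) (Factor a) s.

Definition linear_span (K : fieldType) (V : lmodType K) (S : set V) : set V :=
  [set x | exists (k : nat) (c : 'I_k -> K) (v : 'I_k -> V),
     (forall i, S (v i)) /\ x = \sum_(i < k) c i *: v i].

Definition finite_sums (V : zmodType) (S : set V) : set V :=
  [set x | exists (k : nat) (v : 'I_k -> V),
     (forall i, S (v i)) /\ x = \sum_(i < k) v i].

Section NonassociativeAlgebra.
Variables (K : fieldType) (A : vectType K) (mul : {bilinear A -> A -> A}).

Definition jacobian (x y z : A) : A :=
  mul (mul x y) z + mul (mul y z) x + mul (mul z x) y.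

Definition malcev : Prop :=
  (forall x : A, mul x x = 0) /\
  (forall x y z : A, jacobian x y (mul x z) = mul (jacobian x y z) x).

(* A^n, meaningful for n >= 1. *)
Definition right_power (n : nat) : set A :=
  linear_span [set x | exists (a : A) (s : seq A),
    product_length (right_product a s) = n /\
    x = product_value mul (right_product a s)].

(* A^<n> *)
Definition strong_power (n : nat) : set A :=
  finite_sums [set x | exists p : product A,
    (n <= product_length p)%N /\ x = product_value mul p].

Definition right_nilpotent_of_index (n : nat) : Prop :=
  [/\ (1 <= n)%N, right_power n = [set 0] &
      forall m : nat, (1 <= m)%N -> right_power m = [set 0] -> (n <= m)%N].

Definition strongly_nilpotent_of_index (n : nat) : Prop :=
  [/\ (1 <= n)%N, strong_power n = [set 0] &
      forall m : nat, (1 <= m)%N -> strong_power m = [set 0] -> (n <= m)%N].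

End NonassociativeAlgebra.

(* Main.v *)
Require Import Defs.
From mathcomp Require Import all_boot all_order all_algebra.
From mathcomp Require Import boolp classical_sets.
From mathcomp Require Import ring zify.

(** The Malcev identity, linearized, yields Sagle's identity
    [(xz)(yt) = ((xy)z)t + ((yz)t)x + ((zt)x)y + ((tx)y)z] (here 2 has to be
    invertible).  Read as a statement about the right multiplications
    [R_c : y |-> y c], it says
    [R_((zt)x) = R_t R_(xz) - R_x R_z R_t + R_z R_t R_x - R_(tx) R_z]
    (operators composed from left to right), so by induction the right
    multiplication by a product of length [l] is a combination of compositions
    of at least [l/2] right multiplications.  Hence every product of length at
    least [2n - 1] is a combination of right products of length at least [n],
    and the index of strong nilpotence is even at most [2n - 1]. *)

Import GRing.Theory.
Local Open Scope ring_scope.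

Section Malcev.
Variables (K : fieldType) (A : vectType K) (mul : {bilinear A -> A -> A}).
Hypotheses (charK : 2%N \notin [pchar K]) (A_malcev : malcev mul).

Lemma malcev_anticomm (x y : A) : mul x y = - mul y x.
Proof.
have [sq0 _] := A_malcev; apply/eqP; rewrite -addr_eq0.
by have := sq0 (x + y); rewrite linearDl /= !linearDr /= !sq0 add0r addr0 => ->.
Qed.

(** Substitute [x + w] for [x] in the Malcev identity and keep the terms mixed in [x] and [w]. *)
Lemma malcev_linearized (x w y z : A) :
  jacobian mul x y (mul w z) + jacobian mul w y (mul x z) =
  mul (jacobian mul x y z) w + mul (jacobian mul w y z) x.
Proof.
have [_ malc] := A_malcev.
have addJ (v : A) : jacobian mul (x + w) y v
    = jacobian mul x y v + jacobian mul w y v.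
  rewrite /jacobian !(linearDl, linearDr) /=.
  by rewrite [RHS]addrACA [X in X + _ = _]addrACA.
have addJr (u v v' : A) : jacobian mul u y (v + v')
    = jacobian mul u y v + jacobian mul u y v'.
  rewrite /jacobian !(linearDl, linearDr) /=.
  by rewrite [RHS]addrACA [X in X + _ = _]addrACA.
move: malc addJ addJr; move: (jacobian mul) => J malc addJ addJr.
have := malc (x + w) y z.
rewrite linearDr /= !addJ !linearDl /= !addJr !malc.
rewrite -!addrA => /addrI; rewrite !addrA => /addIr ->.
by rewrite addrC.
Qed.

Lemma sagle_identity (x y z t : A) :
  mul (mul x z) (mul y t) =
  mul (mul (mul x y) z) t + mul (mul (mul y z) t) x
  + mul (mul (mul z t) x) y + mul (mul (mul t x) y) z.
Proof.
have two_neq0 : 2%:R != 0 :> K by move: charK; rewrite !inE.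
have anti := malcev_anticomm.
have M1 := malcev_linearized x y z t.
have M2 := malcev_linearized x z t y.
have M3 := malcev_linearized t x y z.
apply: (scalerI two_neq0); move: M1 M2 M3; rewrite /jacobian.
rewrite !linearDl /=.
(* Anticommutativity gives each monomial one normal form up to sign, so that equal monomials become
   the same atom for [ring]. *)
rewrite ?(anti y x) ?(anti z x) ?(anti t x) ?(anti z y) ?(anti t y) ?(anti t z).
rewrite !(linearNl, linearNr) /=.
rewrite ?(anti x (mul _ _)) ?(anti y (mul _ _)) ?(anti z (mul _ _)).
rewrite ?(anti t (mul _ _)).
rewrite !(linearNl, linearNr) /=.
rewrite ?(anti (mul z t) (mul x y)) ?(anti (mul y t) (mul x z)).
rewrite ?(anti (mul y z) (mul x t)).
move=> M1 M2 M3.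
(* Compare coordinates: the identity becomes one in the field [K], where [ring] applies. *)
rewrite [LHS](coord_vbasis (memvf _)) [RHS](coord_vbasis (memvf _)).
apply: eq_bigr => i _; congr (_ *: _).
move: M1 M2 M3; set f := coord _ i.
have fD u v : f (u + v) = f u + f v by exact: linearD.
have fN u : f (- u) = - f u by exact: linearN.
have fZ (c : K) u : f (c *: u) = c * f u by exact: linearZ.
move=> /(congr1 f) M1 /(congr1 f) M2 /(congr1 f) M3.
rewrite !fZ; move: M1 M2 M3; rewrite !(fD, fN).
have sub0 (a b : K) : a = b -> a - b = 0 by move=> ->; rewrite subrr.
move=> /sub0 M1 /sub0 M2 /sub0 M3.
(* Twice the identity is [M1 - M2 + M3], up to anticommutativity. *)
rewrite -[LHS]subr0 -M1 -[LHS]addr0 -M2 -[LHS]subr0 -M3.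
by ring.
Qed.

Lemma right_mul_triple (x y z t : A) :
  mul y (mul (mul z t) x) =
  mul (mul y t) (mul x z) - mul (mul (mul y x) z) t
  + mul (mul (mul y z) t) x - mul (mul y (mul t x)) z.
Proof.
have anti := malcev_anticomm.
have := sagle_identity x y z t.
rewrite (anti (mul x z)) (anti x y) (anti (mul (mul z t) x)) (anti (mul t x)).
rewrite !linearNl /= addrAC => /(canLR (subrK _)) sagle.
by rewrite -[LHS](addNKr (mul (mul y t) (mul x z))) sagle !addrA.
Qed.

Lemma foldl_mul_linear (s : seq A) (a : K) (x y : A) :
  foldl mul (a *: x + y) s = a *: foldl mul x s + foldl mul y s.
Proof. by elim: s x y => //= c s IHs x y; rewrite linearPl /= IHs. Qed.

Lemma product_value_right_product (a : A) (s : seq A) :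
  product_value mul (right_product a s) = foldl mul a s.
Proof.
rewrite /right_product -[a in RHS]/(product_value mul (Factor a)).
by elim: s (Factor a) => //= c s IHs p; rewrite IHs.
Qed.

Lemma product_length_right_product (V : Type) (a : V) (s : seq V) :
  product_length (right_product a s) = (size s).+1.
Proof.
rewrite /right_product -add1n -[1%N]/(product_length (Factor a)).
by elim: s (Factor a) => [|c s IHs] p /=; rewrite ?addn0 // IHs /= -addnA.
Qed.

Lemma product_length_gt0 (V : Type) (p : product V) : (0 < product_length p)%N.
Proof. by elim: p => //= p p_gt0 q _; rewrite addn_gt0 p_gt0. Qed.

Lemma right_power0_foldl (n : nat) :
  right_power mul n.+1 = [set 0]%classic ->
  forall (a : A) (s : seq A), (n <= size s)%N -> foldl mul a s = 0.
Proof.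
move=> pow0 a s le_n_s.
have foldl0 t : foldl mul 0 t = 0 :> A.
  by elim: t => //= c t IHt; rewrite linear0l.
(* The first [n.+1] factors form a right product of exactly the vanishing length; the remaining ones
   multiply 0. *)
suff take0 : foldl mul a (take n s) = 0.
  by rewrite -(cat_take_drop n s) foldl_cat take0 foldl0.
suff : right_power mul n.+1 (foldl mul a (take n s)) by rewrite pow0.
exists 1%N, (fun=> 1), (fun=> foldl mul a (take n s)); split; last first.
  by rewrite big_ord1 scale1r.
move=> _; exists a, (take n s).
by rewrite product_length_right_product product_value_right_product size_takel.
Qed.

Section RightDepth.
Variable N : nat.

(* When right products of more than [N] factors vanish, [depth k x] holds as
   soon as [x] is a combination of right products of more than [k] factors. *)
Definition depth (k : nat) (x : A) : Prop :=
  forall s : seq A, (N <= size s + k)%N -> foldl mul x s = 0.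

Lemma depthW (j k : nat) (x : A) : depth k x -> (j <= k)%N -> depth j x.
Proof. by move=> dx le_jk s le_N; apply: dx; lia. Qed.

Lemma depthP (k : nat) (a : K) (x y : A) :
  depth k x -> depth k y -> depth k (a *: x + y).
Proof.
by move=> dx dy s le_N; rewrite foldl_mul_linear dx // dy // scaler0 addr0.
Qed.

Lemma depthD (k : nat) (x y : A) : depth k x -> depth k y -> depth k (x + y).
Proof. by rewrite -[x in (x + y)%R]scale1r; apply: depthP. Qed.

Lemma depthB (k : nat) (x y : A) : depth k x -> depth k y -> depth k (x - y).
Proof. by move=> dx dy; rewrite addrC -scaleN1r; apply: depthP. Qed.

Lemma depthN (k : nat) (x : A) : depth k x -> depth k (- x).
Proof.
move=> dx; rewrite -sub0r; apply: depthB => //.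
by rewrite -(subrr x); apply: depthB.
Qed.

Lemma depthM (k : nat) (x c : A) : depth k x -> depth k.+1 (mul x c).
Proof. by move=> dx s le_N; apply: (dx (c :: s)); rewrite /= addSnnS. Qed.

(** Each term of [right_mul_triple] multiplies successively by shorter products, and [uphalf] is
    subadditive, so no depth is lost. Lengths 1 and 2 both count for one multiplication. *)
Lemma depth_mul_product (p : product A) (k : nat) (y : A) : depth k y ->
  depth (k + uphalf (product_length p)) (mul y (product_value mul p)).
Proof.
have depth_mul1 q j u : (product_length q <= 2)%N -> depth j u ->
    depth (j + uphalf (product_length q)) (mul u (product_value mul q)).
  move=> le2 du; refine (depthW _ _ _ (depthM _ _ _ du) _).
  by case: (product_length q) le2 => [|[|[|]]] //= _; rewrite ?addn0 ?addn1.
(* The induction is on length, since [Mul x z] and [Mul t x] are not subterms of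
   [Mul (Mul z t) x]. *)
have [m] := ubnP (product_length p).
elim: m => // m IHm in p k y *; rewrite ltnS.
have triple (z t x : product A) :
    (product_length (Mul (Mul z t) x) <= m)%N -> depth k y ->
    depth (k + uphalf (product_length (Mul (Mul z t) x)))
      (mul y (product_value mul (Mul (Mul z t) x))).
  have z_gt0 := product_length_gt0 _ z; have t_gt0 := product_length_gt0 _ t.
  have x_gt0 := product_length_gt0 _ x; move=> /= le_m dy.
  rewrite /= right_mul_triple.
  apply: depthB; [apply: depthD; [apply: depthB|]|].
  - refine (depthW _ _ _ (IHm (Mul x z) _ _ _ (IHm t _ _ _ dy)) _) => /=; lia.
  - by refine (depthW _ _ _ (IHm t _ _ _ (IHm z _ _ _ (IHm x _ _ _ dy))) _); lia.
  - by refine (depthW _ _ _ (IHm x _ _ _ (IHm t _ _ _ (IHm z _ _ _ dy))) _); lia.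
  - refine (depthW _ _ _ (IHm z _ _ _ (IHm (Mul t x) _ _ _ dy)) _) => /=; lia.
case: p => [x|[x|z t] [x'|z' t']] le_m dy; try by apply: depth_mul1.
(* Anticommutativity moves the composite factor to the left, where [triple] applies. *)
- have -> : mul y (product_value mul (Mul (Factor x) (Mul z' t'))) =
      - mul y (product_value mul (Mul (Mul z' t') (Factor x))).
    by rewrite /= (malcev_anticomm x) linearNr.
  have := triple z' t' (Factor x); rewrite /= [(_ + 1)%N]addnC add0n.
  by move=> dtriple; apply: depthN; apply: dtriple.
- exact: triple.
- exact: triple.
Qed.

End RightDepth.

(** A single factor has depth 0; multiplying [p1] by [p2] adds half the length of [p2], rounded
    up. *)
Lemma depth_product (N : nat) (p : product A) :
  right_power mul N.+1 = [set 0]%classic ->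
  depth N (product_length p)./2 (product_value mul p).
Proof.
move=> pow0; elim: p => [x|p1 IHp1 p2 _] /=.
  by move=> s; rewrite addn0; apply: right_power0_foldl.
by refine (depthW _ _ _ _ (depth_mul_product _ _ _ _ IHp1) _); lia.
Qed.

End Malcev.

Theorem mainTheorem1 (K : fieldType) (A : vectType K)
    (mul : {bilinear A -> A -> A}) (n : nat)
    (charK : 2%N \notin [pchar K]) (A_malcev : malcev mul) (n_ge1 : (1 <= n)%N)
    (A_nil : right_nilpotent_of_index mul n) :
  exists m : nat, strongly_nilpotent_of_index mul m /\
    (m <= 4 * n ^ 2 - 2 * n + 1)%N.
Proof.
case: n n_ge1 A_nil => // n _ [_ pow0 _].
(* Here the index of right nilpotence is [n.+1], so this exponent is twice the index minus one. *)
have strong0 : strong_power mul n.*2.+1 = [set 0]%classic.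
  apply/seteqP; split => [_ [k [v [v_prod ->]]]|_ ->] /=; last first.
    by exists 0%N, (fun=> 0); split=> [[]|]; rewrite ?big_ord0.
  apply: big1 => i _; have [p [len_p ->]] := v_prod i.
  have := depth_product _ _ _ charK A_malcev n p pow0.
  (* For the empty list, depth at least [n] says that the product itself is 0. *)
  by move/(_ [::]); apply; rewrite add0n; lia.
pose null m := (0 < m)%N && `[< strong_power mul m = [set 0]%classic >].
have ex_null : exists m, null m.
  by exists n.*2.+1; apply/andP; split=> //; apply/asboolP.
case: (ex_minnP ex_null) => m /andP[m_gt0 /asboolP m_null] m_min.
have min_m j : (0 < j)%N -> strong_power mul j = [set 0]%classic -> (m <= j)%N.
  by move=> j_gt0 j_null; apply: m_min; apply/andP; split=> //; apply/asboolP.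
exists m; split; first by split.
by apply: leq_trans (min_m _ _ strong0) _ => //; nia.
Qed.
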